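(* Let $V\subseteq O(k)$ be a finite nontrivial subgroup. Then the set $$D_V=\{X\in H(k)\mid\mathrm{Sym}(X)=V\}$$ is either empty or locally closed in $H(k)$. In particular, if $V$ is maximal, then $D_V$ is closed in $H(k)$.
   Context: Fix $n\geq 2$ and $k\geq 1$. $\mathrm{Conf}_n(\mathbb{R}^k)$ is the space of unordered configurations, i.e. subsets of $n$ distinct points of $\mathbb{R}^k$, with its usual topology. $H(k)\subset\mathrm{Conf}_n(\mathbb{R}^k)$ is the subspace of configurations whose barycenter $\frac1n\sum_{x\in X}x$ is the origin. For $X\in H(k)$, $\mathrm{Sym}(X)=\{g\in\mathrm{Iso}(\mathbb{R}^k)\mid g(X)=X\}$, which is a subgroup of the orthogonal group $O(k)$. A finite subgroup $V\subseteq O(k)$ is called maximal if it is not properly contained in the symmetry group of any configuration. *)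

(* Defs.v *)
From HB Require Import structures.
From mathcomp Require Import all_boot all_order all_algebra.
From mathcomp Require Import all_classical all_reals all_analysis.

Set Implicit Arguments.
Unset Strict Implicit.
Unset Printing Implicit Defensive.

Import Order.TTheory GRing.Theory Num.Theory.
Import numFieldNormedType.Exports.

Local Open Scope classical_set_scope.
Local Open Scope card_scope.
Local Open Scope ring_scope.

(* The norm that the library puts on matrices is the sup norm: it gives the
   usual topology of R^k but the wrong isometries. *)
Definition euclidean_dist (R : realType) (k : nat) (x y : 'cV[R]_k) : R :=
  Num.sqrt (\sum_i (x i 0 - y i 0) ^+ 2).

Definition Iso (R : realType) (k : nat) : set ('cV[R]_k -> 'cV[R]_k) :=
  [set g | bijective g /\
     forall x y, euclidean_dist (g x) (g y) = euclidean_dist x y].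

(* The orthogonal group, as the group of transformations of R^k given by the
   orthogonal matrices. *)
Definition orthogonal_group (R : realType) (k : nat) :
    set ('cV[R]_k -> 'cV[R]_k) :=
  [set g | exists2 A : 'M[R]_k, A^T *m A = 1%:M & g = mulmx A].
Arguments orthogonal_group : clear implicits.

Definition transformation_group (T : Type) (V : set (T -> T)) : Prop :=
  [/\ V idfun,
      forall f g, V f -> V g -> V (f \o g) &
      forall f g, V f -> cancel f g -> cancel g f -> V g].

Definition ordered_conf (R : realType) (n k : nat) : topologicalType :=
  set_type [set x : {ptws 'I_n -> 'cV[R]_k} | injective x].

Definition npoint_set (R : realType) (n k : nat) : Type :=
  {X : set 'cV[R]_k | X #= `I_n}.

Section QuotientMap.
Variables (R : realType) (n k : nat).
Implicit Types (x : ordered_conf R n k) (X : npoint_set R n k).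

Lemma ordered_conf_inj x : injective (\val x : 'I_n -> 'cV[R]_k).
Proof. by have /set_mem := valP x. Qed.

Fact range_card x : range (\val x : 'I_n -> 'cV[R]_k) #= `I_n.
Proof.
have /card_eqPle[leI geI] : `I_n #= [set: 'I_n] by exact: card_II.
have /card_eqPle[leX geX] : range (\val x : 'I_n -> 'cV[R]_k) #= [set: 'I_n].
  by apply: inj_card_eq => i j _ _; exact: ordered_conf_inj.
by apply/card_eqPle; split; [exact: card_le_trans geI|exact: card_le_trans geX].
Qed.

Definition unorder x : npoint_set R n k :=
  exist _ (range (\val x)) (range_card x).

Fact unorder_surj X : exists x, unorder x = X.
Proof.
case: X => X cX.
have /card_eqPle[leI geI] : `I_n #= [set: 'I_n] by exact: card_II.
have /card_eqPle[leX geX] := cX.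
have /card_bijP[f [g fK gK]] : [set: 'I_n] #= X.
  by apply/card_eqPle; split; [exact: card_le_trans geX|exact: card_le_trans leI].
have memT (i : 'I_n) : i \in [set: 'I_n] by rewrite in_setT.
pose x (i : 'I_n) : 'cV[R]_k := \val (f (exist _ i (memT i))).
have x_inj : injective x.
  by move=> i j /val_inj /(can_inj fK) /(congr1 \val).
have xP : (x : {ptws 'I_n -> 'cV[R]_k}) \in
    [set x : {ptws 'I_n -> 'cV[R]_k} | injective x] by apply/mem_set.
exists (exist _ (x : {ptws 'I_n -> 'cV[R]_k}) xP).
apply: eq_exist => /=; apply/seteqP; split=> [_ [i _ <-]|y Xy].
  exact: set_mem (valP (f _)).
have yP := mem_set Xy; exists (\val (g (exist _ y yP))) => //.
rewrite /x (_ : exist _ _ _ = g (exist _ y yP)); last exact/val_inj.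
by rewrite gK.
Qed.

Definition choose_order X : ordered_conf R n k := projT1 (cid (unorder_surj X)).

Fact choose_orderK : cancel choose_order unorder.
Proof. by move=> X; rewrite /choose_order; case: cid. Qed.

HB.instance Definition _ :=
  isQuotient.Build (ordered_conf R n k) (npoint_set R n k) choose_orderK.

End QuotientMap.

(* The n-point subsets of R^k, with the topology coinduced by [unorder], i.e.
   that of the orbit space of [ordered_conf] under the permutations of 'I_n. *)
Definition Conf (R : realType) (n k : nat) : topologicalType :=
  @quotient_topology (ordered_conf R n k) (npoint_set R n k).

Definition points (R : realType) (n k : nat) (X : Conf R n k) : set 'cV[R]_k :=
  sval (X : npoint_set R n k).

Definition barycenter (R : realType) (n k : nat) (X : Conf R n k) : 'cV[R]_k :=
  n%:R^-1 *: \sum_(x \in points X) x.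

(* H(k), with the subspace topology. *)
Definition centered_Conf (R : realType) (n k : nat) : topologicalType :=
  set_type [set X : Conf R n k | barycenter X = 0].

Definition Sym (R : realType) (n k : nat) (X : centered_Conf R n k) :
    set ('cV[R]_k -> 'cV[R]_k) :=
  [set g | Iso g /\ g @` points (\val X) = points (\val X)].

Definition D (R : realType) (n k : nat) (V : set ('cV[R]_k -> 'cV[R]_k)) :
    set (centered_Conf R n k) :=
  [set X | Sym X = V].
Arguments D {R} n {k} V.

(* Meant for a finite subgroup [V] of the orthogonal group.  Symmetry groups
   are only considered for centered configurations; this loses nothing, since
   a linear group of symmetries of X fixes the barycenter of X, so that it is
   also a group of symmetries of the translate of X centered at 0. *)
Definition maximal_symmetry (R : realType) (n k : nat)
    (V : set ('cV[R]_k -> 'cV[R]_k)) : Prop :=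
  forall X : centered_Conf R n k, ~ V `<` Sym X.

Definition locally_closed (T : topologicalType) (A : set T) : Prop :=
  exists U F : set T, [/\ open U, closed F & A = U `&` F].

(* Main.v *)
Require Import Defs.
From HB Require Import structures.
From mathcomp Require Import all_boot all_order all_algebra.
From mathcomp Require Import all_classical all_reals all_analysis.
From mathcomp Require Import lra.

Set Implicit Arguments.
Unset Strict Implicit.
Unset Printing Implicit Defensive.

Import Order.TTheory GRing.Theory Num.Theory.
Import numFieldNormedType.Exports.

Local Open Scope classical_set_scope.
Local Open Scope ring_scope.

(** Write F for the set of the centered configurations X with V contained in
Sym(X).  It is closed, being cut out by the conditions g(X) = X for g in V.
If V is maximal, then D_V = F.  In general it is enough to find an open set U
with D_V equal to the intersection of U and F.

A finite group of matrices is isolated among the groups that contain it: there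
is d > 0 such that every group S containing V, all of whose elements are at
distance less than d from V, equals V ([finite_group_isolated]).  The reason is
that there are no small subgroups: near 1, squaring a matrix roughly doubles
its distance to 1, so the iterated squares of an element of S that is close to
1, but not equal to it, must at some time be at a distance from 1 that is
neither very small nor large enough to be near another element of V.

Let K be the set of the orthogonal matrices at distance at least d from V, and U
the set of the configurations that no element of K stabilizes.  If Sym(X) = V
then X lies in U, since K does not meet V.  Conversely, if X lies in both U and
F, then Sym(X) contains V and consists of orthogonal matrices
([Sym_orthogonal]), none of which is in K, so Sym(X) = V by isolation.

Finally U is open because K is compact ([stabilized_by_closed]): the pairs of
an ordered configuration and a matrix A that permutes its points form a closed
set, and projecting along a compact factor preserves closedness.  Only the
quotient by reordering and the restriction to centered configurations are then
left to go through. *)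

(** * Matrices over the reals, with the sup norm *)

Section MatrixNorm.
Variable R : realType.

Lemma mx_norm_entry m n (A : 'M[R]_(m, n)) i j : `|A i j| <= `|A|.
Proof.
rewrite [leRHS]/Num.norm /= mx_normrE; apply/bigmax_geP; right => /=.
by exists (i, j).
Qed.

Lemma mx_norm_le m n (A : 'M[R]_(m, n)) (c : R) :
  0 <= c -> (forall i j, `|A i j| <= c) -> `|A| <= c.
Proof.
move=> c0 Ac; rewrite [leLHS]/Num.norm /= mx_normrE.
by apply/bigmax_leP; split=> // -[i j] _; exact: Ac.
Qed.

Lemma mx_norm_mul m n p (A : 'M[R]_(m, n)) (B : 'M[R]_(n, p)) :
  `|A *m B| <= n%:R * `|A| * `|B|.
Proof.
apply: mx_norm_le => [|i j]; first by rewrite !mulr_ge0.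
rewrite mxE; apply: le_trans (ler_norm_sum _ _ _) _.
apply: (@le_trans _ _ (\sum_(l < n) `|A| * `|B|)); last first.
  by rewrite sumr_const card_ord -mulrA mulr_natl.
by apply: ler_sum => l _; rewrite normrM ler_pM ?mx_norm_entry.
Qed.

Lemma continuous_mx (T : topologicalType) m n (F : T -> 'M[R]_(m, n)) :
  (forall i j, continuous (fun t => F t i j)) -> continuous F.
Proof.
move=> cF t; apply/cvg_ballP => e e0.
have : \forall u \near t, forall i j, ball (F t i j) e (F u i j).
  apply: filter_forall => i; apply: filter_forall => j.
  by have /cvg_ballP/(_ e e0) := cF i j t.
by apply: filterS => u; split.
Qed.

Lemma continuous_mulmx (T : topologicalType) m n p
    (F : T -> 'M[R]_(m, n)) (G : T -> 'M[R]_(n, p)) :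
  continuous F -> continuous G -> continuous (fun t => F t *m G t).
Proof.
move=> cF cG; apply: continuous_mx => i j t.
rewrite (_ : (fun u => _) = (fun u => \sum_l F u i l * G u l j)); last first.
  by apply/funext => u; rewrite mxE.
apply: (continuous_big add_continuous) => l _ u.
apply: cvgM.
  by apply: (cvg_comp _ (fun M : 'M[R]_(m, n) => M i l) (cF u));
     exact: coord_continuous.
by apply: (cvg_comp _ (fun M : 'M[R]_(n, p) => M l j) (cG u));
   exact: coord_continuous.
Qed.

(** Heine-Borel for matrices is transported from row vectors: reshaping is
continuous and does not increase the sup norm. *)
Lemma bounded_closed_compact_mx m n (K : set 'M[R]_(m, n)) (c : R) :
  (forall A, K A -> `|A| <= c) -> closed K -> compact K.
Proof.
move=> Kc clK.
have vec_mxc : continuous (@vec_mx R m n).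
  apply: continuous_mx => i j.
  rewrite (_ : (fun v => _) = (fun v : 'rV_(m * n) => v 0 (mxvec_index i j))).
    exact: coord_continuous.
  by apply/funext => v; rewrite mxE.
have -> : K = vec_mx @` (vec_mx @^-1` K).
  apply/seteqP; split=> [A KA|_ [v Kv <-] //].
  by exists (mxvec A); rewrite /= mxvecK.
apply: continuous_compact; first exact: continuous_subspaceT.
apply: bounded_closed_compact; last first.
  by apply: closed_comp => // v _; exact: vec_mxc.
exists c; split; first exact: num_real.
move=> c' cc' v /Kc vc; apply: le_trans (ltW cc').
apply: mx_norm_le => [|i l]; first exact: le_trans vc.
rewrite ord1; case/mxvec_indexP: l => a b.
by apply: le_trans vc; apply: le_trans (mx_norm_entry _ a b); rewrite mxE.
Qed.

End MatrixNorm.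

(** Points outside the projection have, above each point of K, a product
neighbourhood that avoids C; compactness makes the choice uniform. *)
Lemma closed_projection (X Y : topologicalType) (K : set Y) (C : set (X * Y)) :
  compact K -> closed C -> closed [set x | exists2 y, K y & C (x, y)].
Proof.
move=> /compact_near_coveringP cK clC; rewrite -openC openE => x nx.
suff : \forall x' \near x, K `<=` (fun y => ~ C (x', y)).
  by apply: filterS => x' nC [y Ky]; exact: nC.
apply: cK => y Ky.
have nC : (~` C) (x, y) by move=> Cxy; apply: nx; exists y.
have : nbhs (x, y) (~` C).
  by apply: open_nbhs_nbhs; split => //; exact: closed_openC.
case=> [[P Q] /= [Px Qy] PQ]; exists (Q, P) => //= -[y' x'] [Qy' Px'].
exact: PQ.
Qed.

(** * Groups near a finite orthogonal group *)

Section SmallSubgroups.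
Variables (R : realType) (k : nat).
Implicit Types (A B : 'M[R]_k) (S W : set 'M[R]_k).

Lemma orthogonal_norm_le1 A : A^T *m A = 1%:M -> `|A| <= 1.
Proof.
move=> AA; apply: mx_norm_le => // i j.
have Aj : \sum_l A l j ^+ 2 = 1.
  have := congr1 (fun B : 'M[R]_k => B j j) AA; rewrite !mxE eqxx.
  by apply: etrans; apply: eq_bigr => l _; rewrite mxE.
rewrite -(@expr_le1 _ 2) // real_normK ?num_real // -Aj (bigD1 i) //=.
by rewrite lerDl sumr_ge0 // => l _; exact: sqr_ge0.
Qed.

(** With B = A - 1, the difference A ^ 2 - 1 is 2 B + B ^ 2, and the quadratic
term is at most half of B in norm. *)
Lemma squaring_expands A : 2 * k%:R * `|A - 1%:M| <= 1 ->
  3 / 2 * `|A - 1%:M| <= `|A *m A - 1%:M| <= 5 / 2 * `|A - 1%:M|.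
Proof.
set B := A - 1%:M => Bsmall.
have -> : A *m A - 1%:M = B *+ 2 + B *m B.
  have -> : A = B + 1%:M by rewrite subrK.
  by rewrite mulmxDl mulmxDr mulmx1 mul1mx addrA addrK mulr2n -addrA addrC.
have BB : `|B *m B| <= `|B| / 2.
  apply: le_trans (mx_norm_mul _ _) _.
  rewrite [leRHS]mulrC; apply: ler_wpM2r => //; lra.
have := lerB_normD (B *+ 2) (B *m B); have := ler_normD (B *+ 2) (B *m B).
rewrite normrMn mulr2n => h1 h2; apply/andP; split; lra.
Qed.

(** By the gap hypothesis, squaring keeps an element of S that is within c of 1
within c of 1, while multiplying its distance to 1 by at least 3 / 2.  This can
be repeated forever only at distance 0. *)
Lemma no_small_subgroup S (c : R) : 2 * k%:R * c <= 1 ->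
  (forall A, S A -> S (A *m A)) ->
  (forall A, S A -> `|A - 1%:M| < 3 * c -> `|A - 1%:M| < c) ->
  forall A, S A -> `|A - 1%:M| < c -> A = 1%:M.
Proof.
move=> kc Ssq gap.
have small A : `|A - 1%:M| < c -> 2 * k%:R * `|A - 1%:M| <= 1.
  by move=> Ac; apply: le_trans kc; apply: ler_wpM2l (ltW Ac); rewrite mulr_ge0.
(* The linear lower bound 1 + m / 2 for the growth (3 / 2) ^ m of the
   m-th iterated square is all that is needed. *)
have growth m A : S A -> `|A - 1%:M| < c -> (1 + m%:R / 2) * `|A - 1%:M| <= c.
  elim: m A => [|m IH] A SA Ac; first by rewrite mul0r addr0 mul1r ltW.
  have /andP[lo hi] := squaring_expands (small A Ac).
  have a0 : 0 <= `|A - 1%:M| by [].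
  have AAc : `|A *m A - 1%:M| < c.
    by apply: gap; [exact: Ssq | apply: le_lt_trans hi _; lra].
  apply: le_trans (IH _ (Ssq _ SA) AAc).
  apply: (@le_trans _ _ ((1 + m%:R / 2) * (3 / 2 * `|A - 1%:M|))).
    rewrite mulrA; apply: ler_wpM2r => //; rewrite -[m.+1%:R]natr1.
    by have : 0 <= m%:R :> R by []; lra.
  by apply: (ler_wpM2l _ lo); have : 0 <= m%:R :> R by []; lra.
move=> A SA Ac; apply/eqP; rewrite -subr_eq0 -normr_eq0; apply/negPn/negP => A1.
have a0 : 0 < `|A - 1%:M| by rewrite lt_def A1 /=.
have := growth (Num.bound (2 * c / `|A - 1%:M|)) A SA Ac; apply/negP.
have c0 : 0 < c by apply: lt_trans Ac.
rewrite -ltNge -ltr_pdivrMr //.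
have := archi_boundP (_ : 0 <= 2 * c / `|A - 1%:M|).
by rewrite divr_ge0 ?mulr_ge0 ?ltW // => /(_ isT); lra.
Qed.

(** An element A of S is close to some B in W, so that B^-1 A is an element of S
close to 1, and [no_small_subgroup] makes it equal to 1.  The gap in S comes
from the gap in W: an element of S at distance less than 3 c from 1 is within c
of an element of W, which is within 4 c of 1 and hence is 1. *)
Lemma finite_group_isolated W : finite_set W ->
  (forall A, W A -> A^T *m A = 1%:M) -> (forall A, W A -> W A^T) ->
  exists2 d : R, 0 < d & forall S, W `<=` S ->
    (forall A B, S A -> S B -> S (A *m B)) ->
    (forall A, S A -> exists2 B, W B & `|A - B| < d) -> S `<=` W.
Proof.
move=> Wfin Worth Wtr.
have [e /= e0 We] : exists2 e : R, 0 < e &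
    forall B, W B -> `|B - 1%:M| < e -> B = 1%:M.
  have clW : closed (W `\ 1%:M).
    have /accessible_finite_set_closed :=
      hausdorff_accessible (@norm_hausdorff R 'M[R]_k).
    by apply; exact: finite_setD.
  have : nbhs (1%:M : 'M[R]_k) (~` (W `\ 1%:M)).
    by apply: open_nbhs_nbhs; split; [exact: closed_openC | case=> _; apply].
  case/nbhs_ballP => e e0 eW; exists e => // B WB Be.
  apply: contrapT => B1; apply: (eW B) => //.
  by rewrite -ball_normE /ball_ /= distrC.
(* The first bound on c is the one for [no_small_subgroup], with k.+1 in place
   of k so that c is positive even for k = 0; the second isolates 1 in W. *)
pose c := Num.min (1 / (2 * k.+1%:R)) (e / 4).
have k1 : 0 < k.+1%:R :> R by [].
have c0 : 0 < c by rewrite lt_min !divr_gt0 ?mulr_gt0.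
have kc : 2 * k.+1%:R * c <= 1.
  by rewrite mulrC -ler_pdivlMr ?mulr_gt0 // ge_min lexx.
have ce : 4 * c <= e by rewrite mulrC -ler_pdivlMr // ge_min lexx orbT.
clearbody c.
have kS : k.+1%:R = k%:R + 1 :> R by rewrite -natr1.
have k0 : 0 <= k%:R :> R by [].
(* Multiplying by an orthogonal matrix can expand the sup norm, but by a factor
   of at most k: being within c / k.+1 of B brings B^-1 A within c of 1. *)
exists (c / k.+1%:R) => [|S WS Smul Sd]; first exact: divr_gt0.
have dc : c / k.+1%:R <= c.
  by rewrite ler_pdivrMr // ler_peMr ?(ltW c0) // kS; lra.
have Sgap A : S A -> `|A - 1%:M| < 3 * c -> `|A - 1%:M| < c.
  move=> SA Ac; have [B WB /lt_le_trans/(_ dc) AB] := Sd A SA.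
  have B1 : B = 1%:M.
    apply: We => //; have := ler_distD A B 1%:M.
    by rewrite (distrC B A) => tri; lra.
  by rewrite -B1; lra.
move=> A SA; have [B WB AB] := Sd A SA.
have BB := Worth B WB; have BBt := mulmx1C BB.
suff BA : B^T *m A = 1%:M by rewrite -[A]mul1mx -BBt -mulmxA BA mulmx1.
apply: (@no_small_subgroup S c) => //.
- by apply: le_trans kc; apply: ler_wpM2r; [exact: ltW | lra].
- by move=> C SC; exact: Smul.
- by apply: Smul => //; exact/WS/Wtr.
rewrite -BB -mulmxBr; apply: le_lt_trans (mx_norm_mul _ _) _.
move: AB; rewrite ltr_pdivlMr // mulrC => AB; apply: le_lt_trans AB.
apply: ler_wpM2r => //; apply: (@le_trans _ _ (k%:R * 1)); last by lra.
by apply: ler_wpM2l => //; apply: orthogonal_norm_le1; exact/Worth/Wtr.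
Qed.

End SmallSubgroups.

(** * Isometries fixing a barycenter *)

Section EuclideanIsometries.
Variables (R : realType) (k : nat).
Implicit Types (x y z : 'cV[R]_k) (A : 'M[R]_k) (g : 'cV[R]_k -> 'cV[R]_k).

Definition dot x y : R := (x^T *m y) 0 0.

Lemma dotC x y : dot x y = dot y x.
Proof. by rewrite /dot -[in LHS](trmxK y) -trmx_mul mxE. Qed.

Lemma dotBr x y z : dot x (y - z) = dot x y - dot x z.
Proof. by rewrite /dot mulmxBr mxE [in X in _ + X]mxE. Qed.

Lemma sqr_distE x y : \sum_i (x i 0 - y i 0) ^+ 2 = dot (x - y) (x - y).
Proof. by rewrite /dot mxE; apply: eq_bigr => i _; rewrite !mxE expr2. Qed.

Lemma euclidean_distE x y :
  euclidean_dist x y = Num.sqrt (dot (x - y) (x - y)).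
Proof. by rewrite /euclidean_dist sqr_distE. Qed.

Lemma dot_ge0 x : 0 <= dot x x.
Proof. by rewrite -[x]subr0 -sqr_distE sumr_ge0 // => i _; exact: sqr_ge0. Qed.

Lemma dot_polarization x y :
  2 * dot x y = dot x x + dot y y - dot (x - y) (x - y).
Proof. rewrite dotBr ![dot (x - y) _]dotC !dotBr (dotC y x); lra. Qed.

Lemma orthogonal_inj A : A^T *m A = 1%:M -> injective (mulmx A : 'cV_k -> _).
Proof.
move=> AA; apply: (can_inj (g := mulmx A^T)) => x.
by rewrite mulmxA AA mul1mx.
Qed.

Lemma orthogonal_Iso A : A^T *m A = 1%:M -> Iso (mulmx A).
Proof.
move=> AA; split.
  by exists (mulmx A^T) => x; rewrite mulmxA ?AA ?(mulmx1C AA) mul1mx.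
move=> x y; rewrite !euclidean_distE -mulmxBr /dot trmx_mul.
by rewrite -mulmxA (mulmxA A^T) AA mul1mx.
Qed.

Lemma mulmx_col_inj : injective (fun A => mulmx A : 'cV[R]_k -> 'cV[R]_k).
Proof.
move=> A B AB; apply/matrixP => i j.
have := congr1 (fun f : 'cV[R]_k -> 'cV[R]_k => f (delta_mx j 0) i 0) AB.
by rewrite /= -!colE !mxE.
Qed.

Lemma orthogonal_groupP A : orthogonal_group R k (mulmx A) -> A^T *m A = 1%:M.
Proof. by case=> B BB /mulmx_col_inj ->. Qed.

(** After a translation by - g 0 the isometry preserves the dot product.  It is
then given by the matrix A whose columns are the images of the standard basis:
A^T sends the image of x to x, coordinate by coordinate. *)
Lemma isometry_affine g :
  (forall x y, euclidean_dist (g x) (g y) = euclidean_dist x y) ->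
  exists2 A, A^T *m A = 1%:M & forall x, g x = A *m x + g 0.
Proof.
move=> gI; pose h x := g x - g 0.
have hB x y : dot (h x - h y) (h x - h y) = dot (x - y) (x - y).
  have -> : h x - h y = g x - g y by rewrite /h opprB addrA subrK.
  have /(congr1 (fun d => d ^+ 2)) := gI x y.
  by rewrite !euclidean_distE !sqr_sqrtr // dot_ge0.
have h0 : h 0 = 0 by rewrite /h subrr.
have hh x : dot (h x) (h x) = dot x x by have := hB x 0; rewrite h0 !subr0.
have hdot x y : dot (h x) (h y) = dot x y.
  apply: (@mulfI _ 2); first by rewrite pnatr_eq0.
  by rewrite !dot_polarization hB !hh.
pose A : 'M[R]_k := \matrix_(i, j) h (delta_mx j 0) i 0.
have Ah x : A^T *m h x = x.
  apply/colP => i; rewrite mxE.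
  transitivity (dot (h (delta_mx i 0)) (h x)).
    by rewrite /dot mxE; apply: eq_bigr => l _; rewrite !mxE.
  by rewrite hdot /dot trmx_delta -rowE mxE.
have AA : A^T *m A = 1%:M.
  apply/matrixP => i j.
  have <- : (A^T *m h (delta_mx j 0)) i 0 = (A^T *m A) i j.
    by rewrite !mxE; apply: eq_bigr => l _; rewrite !mxE.
  by rewrite Ah !mxE andbT.
exists A => // x.
by rewrite -{2}(Ah x) mulmxA (mulmx1C AA) mul1mx /h subrK.
Qed.

End EuclideanIsometries.

Section Configurations.
Variables (R : realType) (n k : nat).

Lemma points_range (X : Conf R n k) :
  exists x : ordered_conf R n k, points X = range (\val x).
Proof. by have [x <-] := unorder_surj X; exists x. Qed.

(** Since g permutes the points, whose sum is 0, summing g x = A x + g 0 over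
them gives n times g 0 = 0. *)
Lemma Sym_orthogonal (X : centered_Conf R n k) :
  (0 < n)%N -> Sym X `<=` orthogonal_group R k.
Proof.
move=> n0 g [[g_bij gI] gX]; have [A AA gA] := isometry_affine gI.
have : \sum_(p \in points (\val X)) p = 0.
  have /set_mem/= := valP X; rewrite /barycenter => /eqP.
  by rewrite scaler_eq0 invr_eq0 pnatr_eq0 gtn_eqF //= => /eqP.
have [x Xx] := points_range (\val X).
have sumX (F : 'cV[R]_k -> 'cV[R]_k) :
    \sum_(p \in points (\val X)) F p = \sum_i F ((\val x : 'I_n -> 'cV[R]_k) i).
  rewrite Xx fsbig_image; last by move=> i j _ _; exact: ordered_conf_inj.
  rewrite [RHS]fsbig_seq ?index_enum_uniq //; congr (\big[_/_]_(_ \in _) _).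
  by apply/seteqP; split=> i //= _; exact: mem_index_enum.
move=> sum0; have := sum0; rewrite -gX fsbig_image; last first.
  by move=> p q _ _; exact: bij_inj.
rewrite sumX (eq_bigr _ (fun i _ => gA _)) big_split /= -mulmx_sumr.
rewrite -(sumX id) sum0 mulmx0 add0r sumr_const card_ord => /eqP.
rewrite -scaler_nat scaler_eq0 pnatr_eq0 gtn_eqF //= => /eqP g0.
by exists A => //; apply/funext => p; rewrite gA g0 addr0.
Qed.

Lemma orthogonal_Sym (X : centered_Conf R n k) (A : 'M[R]_k) :
  A^T *m A = 1%:M -> mulmx A @` points (\val X) = points (\val X) ->
  Sym X (mulmx A).
Proof. by move=> /orthogonal_Iso AI AX; split. Qed.

(** * Configurations stabilized by some matrix of a compact set *)

Definition stabilized_by (K : set 'M[R]_k) : set (centered_Conf R n k) :=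
  [set X | exists2 A, K A & mulmx A @` points (\val X) = points (\val X)].

(** In terms of ordered configurations the set is a finite union, over the
injections s of the index set into itself, of projections along K of the closed
conditions A x_i = x_(s i).  An injection of a finite set into itself is onto,
so these conditions say that A maps the configuration onto itself. *)
Lemma stabilized_by_closed (K : set 'M[R]_k) :
  (forall A, K A -> A^T *m A = 1%:M) -> compact K -> closed (stabilized_by K).
Proof.
move=> Korth Kcompact.
pose C (s : {ffun 'I_n -> 'I_n}) : set ({ptws 'I_n -> 'cV[R]_k} * 'M[R]_k) :=
  [set xA | forall i, xA.2 *m xA.1 i = xA.1 (s i)].
have Cclosed s : closed (C s).
  rewrite (_ : C s = \bigcap_i
      ((fun xA => xA.2 *m xA.1 i - xA.1 (s i)) @^-1` [set 0])); last first.
    apply/seteqP; split=> xA CxA i; first by move=> _ /=; rewrite CxA subrr.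
    by apply/subr0_eq; exact: CxA.
  apply: closed_bigI => i _; apply: closed_comp; last first.
    exact/accessible_closed_set1/hausdorff_accessible/norm_hausdorff.
  move=> xA _.
  have ev j : continuous (fun xA : {ptws 'I_n -> 'cV[R]_k} * 'M[R]_k => xA.1 j).
    move=> p; apply: (cvg_comp _ (fun x : {ptws 'I_n -> 'cV[R]_k} => x j)).
      exact: cvg_fst.
    exact: (@proj_continuous _ (fun=> 'cV[R]_k)).
  apply: cvgB; last exact: ev.
  apply: continuous_mulmx; last exact: ev.
  move=> p; exact: cvg_snd.
pose E : set (Conf R n k) :=
  [set X | exists2 A, K A & mulmx A @` points X = points X].
have -> : stabilized_by K = \val @^-1` E by [].
apply: closed_comp => [p _|]; first exact: initial_continuous.
rewrite -openC.
(* Open sets of the quotient topology are by definition those with open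
   preimage. *)
suff : open (\pi_(Conf R n k)%qT @^-1` (~` E)) by [].
have pre : \pi_(Conf R n k)%qT @^-1` E = \val @^-1`
    (\bigcup_(s in [set s : {ffun 'I_n -> 'I_n} | injective s])
      [set x | exists2 A, K A & C s (x, A)]).
  have ptsE x : points (\pi_(Conf R n k)%qT x) = range (\val x).
    by rewrite unlock.
  apply/seteqP; split=> x /=; rewrite /E /= ptsE.
    move=> [A KA AX].
    have /choice[s xs] : forall i, exists j, A *m \val x i = \val x j.
      move=> i; have : range (\val x) (A *m \val x i).
        by rewrite -AX; exists (\val x i) => //; exists i.
      by case=> j _ <-; exists j.
    exists [ffun i => s i]; last by exists A => // i; rewrite ffunE; exact: xs.
    move=> i j; rewrite !ffunE => sij; apply: (ordered_conf_inj (x := x)).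
    by apply: (orthogonal_inj (Korth A KA)); rewrite !xs sij.
  case=> s sinj [A KA /= xs]; exists A => //.
  apply/seteqP; split=> [_ [_ [i _ <-] <-]|_ [j _ <-]].
    by exists (s i) => //; rewrite xs.
  exists (\val x (invF sinj j)); first by exists (invF sinj j).
  by rewrite xs f_invF.
rewrite -preimage_setC pre preimage_setC.
apply: open_comp => [p _|]; first exact: initial_continuous.
apply: closed_openC; apply: closed_bigcup => [|s _]; first exact: finite_finset.
exact: closed_projection.
Qed.

End Configurations.

(** * The locus of configurations with a given symmetry group *)

Section SymmetryLocus.
Variables (R : realType) (n k : nat).
Implicit Types (V : set ('cV[R]_k -> 'cV[R]_k)) (W : set 'M[R]_k).

Lemma subset_Sym_closed V : V `<=` orthogonal_group R k ->
  closed [set X : centered_Conf R n k | V `<=` Sym X].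
Proof.
move=> Vorth.
have Worth A : V (mulmx A) -> A^T *m A = 1%:M.
  by move=> /Vorth; exact: orthogonal_groupP.
have -> : [set X : centered_Conf R n k | V `<=` Sym X] =
    \bigcap_(A in [set A | V (mulmx A)]) stabilized_by [set A].
  apply/seteqP; split=> X /= VX.
    by move=> A /VX[_ AX]; exists A.
  move=> f Vf; have [A AA fA] := Vorth f Vf; rewrite fA in Vf *.
  by have [_ -> AX] := VX A Vf; exact: orthogonal_Sym.
apply: closed_bigI => A VA.
apply: stabilized_by_closed; last exact: compact_set1.
by move=> _ ->; exact: Worth.
Qed.

Lemma orthogonal_far_compact W (d : R) : compact
  [set A : 'M[R]_k | A^T *m A = 1%:M /\ forall B, W B -> d <= `|A - B|].
Proof.
apply: (bounded_closed_compact_mx (c := 1)).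
  by move=> A [AA _]; exact: orthogonal_norm_le1.
apply: closedI.
  apply: (@closed_comp _ _ (fun A : 'M[R]_k => A^T *m A) [set 1%:M]).
    move=> A _; apply: continuous_mulmx; last by move=> M; exact: cvg_id.
    apply: continuous_mx => i j.
    rewrite (_ : (fun B => _) = (fun B : 'M[R]_k => B j i)).
      exact: coord_continuous.
    by apply/funext => B; rewrite mxE.
  exact/accessible_closed_set1/hausdorff_accessible/norm_hausdorff.
suff : closed
    (\bigcap_(B in W) ((fun A : 'M[R]_k => `|A - B|) @^-1` [set r | d <= r])).
  by [].
apply: closed_bigI => B _; apply: closed_comp; last exact: closed_ge.
move=> A _; have AB : (fun C : 'M[R]_k => C - B) @ A --> A - B.
  exact: (cvgB cvg_id (cvg_cst B)).
exact: cvg_norm AB.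
Qed.

(** The orthogonal matrices that are not close to V form a compact set, so that
having no symmetry among them is an open condition; by isolation of V it is all
that is needed to make a symmetry group that contains V equal to V. *)
Lemma D_relatively_open V : (0 < n)%N -> V `<=` orthogonal_group R k ->
  transformation_group V -> finite_set V ->
  exists2 U : set (centered_Conf R n k),
    open U & D n V = U `&` [set X | V `<=` Sym X].
Proof.
move=> n0 Vorth [V1 Vmul Vinv] Vfin.
pose W := [set A : 'M[R]_k | V (mulmx A)].
have Worth A : W A -> A^T *m A = 1%:M.
  by move=> /Vorth; exact: orthogonal_groupP.
have Wfin : finite_set W.
  by apply: finite_preimage Vfin => A B _ _; exact: mulmx_col_inj.
have Wtr A : W A -> W A^T.
  move=> WA; have AA := Worth A WA.
  by apply: (Vinv _ _ WA) => x; rewrite mulmxA ?AA ?(mulmx1C AA) mul1mx.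
have [d d0 isolated] := finite_group_isolated Wfin Worth Wtr.
pose far := [set A : 'M[R]_k |
  A^T *m A = 1%:M /\ forall B, W B -> d <= `|A - B|].
exists (~` stabilized_by far).
  apply: closed_openC; apply: stabilized_by_closed; first by move=> A [].
  exact: orthogonal_far_compact.
apply/seteqP; split=> X.
  move=> /= XV; split; last by rewrite /= XV.
  case=> A [AA Afar] AX.
  have WA : W A by rewrite /W /= -XV; exact: orthogonal_Sym.
  by have := Afar A WA; rewrite subrr normr0 leNgt d0.
move=> [Xfar VX]; apply/seteqP; split=> // g Xg.
have [A AA gA] := Sym_orthogonal n0 Xg.
suff : [set B | Sym X (mulmx B)] `<=` W.
  by move=> /(_ A); rewrite gA; apply; rewrite /= -gA.
apply: isolated => [B /VX //|B C [BI BX] [CI CX]|B [BI BX]].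
  rewrite /=; have -> : mulmx (B *m C) = mulmx B \o mulmx C :> ('cV_k -> 'cV_k).
    by apply/funext => x; rewrite /= mulmxA.
  split; last by rewrite -image_comp CX BX.
  split; first exact: bij_comp BI.1 CI.1.
  by move=> x y; rewrite /= BI.2 CI.2.
apply: contrapT => nB; apply: Xfar; exists B => //; split.
  exact: orthogonal_groupP (Sym_orthogonal n0 (conj BI BX)).
by move=> C WC; rewrite leNgt; apply/negP => BCd; apply: nB; exists C.
Qed.

End SymmetryLocus.

Theorem proposition2p1p6 (R : realType) (n k : nat)
    (hn : (2 <= n)%N) (hk : (1 <= k)%N)
    (V : set ('cV[R]_k -> 'cV[R]_k))
    (V_orthogonal : V `<=` orthogonal_group R k)
    (V_group : transformation_group V)
    (V_finite : finite_set V)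
    (V_nontrivial : V <> [set idfun]) :
  (D n V = set0 \/ locally_closed (D n V)) /\
  (maximal_symmetry n V -> closed (D n V)).
Proof.
have clF := subset_Sym_closed (n := n) V_orthogonal.
have [U opU DUF] :=
  D_relatively_open (ltnW hn) V_orthogonal V_group V_finite.
split; first by right; exists U, [set X | V `<=` Sym X].
move=> Vmax; rewrite (_ : D n V = [set X | V `<=` Sym X]) //.
apply/seteqP; split=> X /= VX; first by rewrite VX.
apply: contrapT => XV; apply: (Vmax X); split=> // SV.
by apply: XV; apply/seteqP.
Qed.
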